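(* There is an embedding $e:\mathrm{CO}(2^{\mathfrak c})\to\mathcal P(\mathbb N)/\mathrm{fin}$ such that $K_e=\{\mathrm{id}\}$, i.e. the only automorphism $h$ of $\mathcal P(\mathbb N)/\mathrm{fin}$ with $h(x)=x$ for every $x$ in the range of $e$ is the identity.
   Context: $\mathfrak c=2^{\aleph_0}$. $\mathrm{CO}(2^{\mathfrak c})$ is the Boolean algebra of clopen subsets of the Cantor cube $2^{\mathfrak c}$ (the free Boolean algebra on $\mathfrak c$ generators). $\mathcal P(\mathbb N)/\mathrm{fin}$ is the Boolean algebra of subsets of $\mathbb N$ modulo finite sets; an embedding is an injective Boolean homomorphism. For an embedding $e:\mathbb B\to\mathbb A$, $K_e=\{h\in\mathrm{Aut}(\mathbb A): h\restriction\mathrm{rng}(e)=\mathrm{id}\}$. This is a ZFC result. *)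

(* Defs.v *)
From HB Require Import structures.
From mathcomp Require Import all_boot all_order.
From mathcomp Require Import generic_quotient.
From mathcomp Require Import all_classical.
From mathcomp Require Import topology.

Set Implicit Arguments.
Unset Strict Implicit.
Unset Printing Implicit Defensive.

Import Order.TTheory.

Local Open Scope classical_set_scope.
Local Open Scope quotient_scope.

(* Boolean algebras are the library's complemented distributive lattices with
   top and bottom, [ctbDistrLatticeType]; order operations are written in
   scope [%O] because [classical_set_scope] uses the same symbols on sets. *)

Section BooleanAlgebras.
Context {d1 d2 : Order.disp_t}.

Definition boolean_hom (B : ctbDistrLatticeType d1)
    (A : ctbDistrLatticeType d2) (f : B -> A) : Prop :=
  [/\ {morph f : x y / (x `&` y)%O},
      {morph f : x y / (x `|` y)%O},
      {morph f : x / (~` x)%O},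
      f \bot%O = \bot%O
    & f \top%O = \top%O].

Definition boolean_embedding (B : ctbDistrLatticeType d1)
    (A : ctbDistrLatticeType d2) (f : B -> A) : Prop :=
  boolean_hom f /\ injective f.

End BooleanAlgebras.

(* The inverse of a bijective homomorphism is again a homomorphism. *)
Definition boolean_automorphism {d : Order.disp_t}
    (A : ctbDistrLatticeType d) (h : A -> A) : Prop :=
  boolean_hom h /\ bijective h.

(* K_e = { h in Aut(A) : h restricted to rng(e) is the identity } *)
Definition pointwise_stabilizer {d1 d2 : Order.disp_t}
    (B : ctbDistrLatticeType d1) (A : ctbDistrLatticeType d2) (e : B -> A) :
    set (A -> A) :=
  [set h | boolean_automorphism h /\ forall x, range e x -> h x = x].

(* The algebra CO(T) of clopen subsets of T, a subalgebra of [set T]. *)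
Section ClopenAlgebra.
Variable T : topologicalType.

Definition clopens : set (set T) := [set A | clopen A].

Record clopen_algebra := ClopenAlgebra {
  clopen_set :> set T;
  _ : clopen_set \in clopens
}.

HB.instance Definition _ := [isSub for clopen_set].
HB.instance Definition _ := [Choice of clopen_algebra by <:].

Fact clopen_meet_closed :
  {in clopens &, forall A B, (A `&` B)%O \in clopens}.
Proof. by move=> A B /set_mem clA /set_mem clB; apply/mem_set/clopenI. Qed.

Fact clopen_join_closed :
  {in clopens &, forall A B, (A `|` B)%O \in clopens}.
Proof. by move=> A B /set_mem clA /set_mem clB; apply/mem_set/clopenU. Qed.

Fact clopen_bot : (\bot%O : set T) \in clopens.
Proof. by rewrite inE; exact: clopen0. Qed.

Fact clopen_top : (\top%O : set T) \in clopens.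
Proof. by rewrite inE; exact: clopenT. Qed.

HB.instance Definition _ :=
  Order.SubChoice_isTBSubLattice.Build _ (set T) _ (Order.Disp tt tt) clopen_algebra
    clopen_meet_closed clopen_join_closed clopen_bot clopen_top.

Fact clopen_algebra_meetUl :
  @left_distributive clopen_algebra clopen_algebra Order.meet Order.join.
Proof. by move=> x y z; apply/val_inj; exact: setIUl. Qed.

HB.instance Definition _ :=
  Order.Lattice_Meet_isDistrLattice.Build (Order.Disp tt tt) clopen_algebra
    clopen_algebra_meetUl.

Fact clopen_compl_subproof (x : clopen_algebra) :
  ~` (x : set T) \in clopens.
Proof. by case: x => A /=; rewrite !inE; exact: clopenC. Qed.

Definition clopen_compl (x : clopen_algebra) : clopen_algebra :=
  ClopenAlgebra (clopen_compl_subproof x).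

Fact clopen_joinxC (x : clopen_algebra) : (x `|` clopen_compl x = \top)%O.
Proof. by apply/val_inj; exact: setUv. Qed.

Fact clopen_meetxC (x : clopen_algebra) : (x `&` clopen_compl x = \bot)%O.
Proof. by apply/val_inj; exact: setICr. Qed.

HB.instance Definition _ :=
  Order.TBDistrLattice_hasComplement.Build (Order.Disp tt tt) clopen_algebra
    clopen_joinxC clopen_meetxC.

Lemma clopen_set_embedding :
  boolean_embedding (clopen_set : clopen_algebra -> set T).
Proof. by split; [split|exact: val_inj]. Qed.

End ClopenAlgebra.

(* Mathcomp-analysis gives [bool] the discrete topology. *)
Definition cantor_cube (I : Type) : topologicalType :=
  prod_topology (fun _ : I => bool).

(* An index set of cardinality 2^aleph_0. *)
Definition continuum : Type := nat -> bool.

Section PowersetModFin.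

Definition eq_mod_fin (A B : set nat) : bool := `[< finite_set (A `+` B) >].

Fact eq_mod_fin_refl : reflexive eq_mod_fin.
Proof. by move=> A; apply/asboolP; rewrite setYK; exact: finite_set0. Qed.

Fact eq_mod_fin_sym : symmetric eq_mod_fin.
Proof. by move=> A B; rewrite /eq_mod_fin setYC. Qed.

Fact eq_mod_fin_trans : transitive eq_mod_fin.
Proof.
move=> B A C /asboolP AB /asboolP BC; apply/asboolP.
have : finite_set ((A `+` B) `|` (B `+` C)) by rewrite finite_setU.
apply: sub_finite_set => x; rewrite /setY /=.
by case: (pselect (B x)); tauto.
Qed.

Canonical eq_mod_fin_equiv :=
  EquivRel eq_mod_fin eq_mod_fin_refl eq_mod_fin_sym eq_mod_fin_trans.

Definition powerset_mod_fin := {eq_quot eq_mod_fin}.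
Local Notation PF := powerset_mod_fin.

HB.instance Definition _ := Choice.on PF.
HB.instance Definition _ := EqQuotient.on PF.

Definition pmf_meet : PF -> PF -> PF := lift_op2 PF setI.
Definition pmf_join : PF -> PF -> PF := lift_op2 PF setU.
Definition pmf_compl : PF -> PF := lift_op1 PF setC.

Lemma pmf_eqP (A B : set nat) :
  \pi_PF A = \pi_PF B <-> finite_set (A `+` B).
Proof. by split=> [/eqmodP/asboolP//|?]; apply/eqmodP/asboolP. Qed.

Let finite_repr (A : set nat) : finite_set (A `+` repr (\pi_PF A)).
Proof. by apply/pmf_eqP; rewrite reprK. Qed.

Fact pi_pmf_meet : {morph \pi_PF : A B / A `&` B >-> pmf_meet A B}.
Proof.
move=> A B; unlock pmf_meet; apply/pmf_eqP.
have : finite_set ((A `+` repr (\pi_PF A)) `|` (B `+` repr (\pi_PF B))).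
  by rewrite finite_setU; split; exact: finite_repr.
apply: sub_finite_set => x; rewrite /setY /=.
by case: (pselect (repr (\pi_PF A) x)); case: (pselect (A x)); tauto.
Qed.

Fact pi_pmf_join : {morph \pi_PF : A B / A `|` B >-> pmf_join A B}.
Proof.
move=> A B; unlock pmf_join; apply/pmf_eqP.
have : finite_set ((A `+` repr (\pi_PF A)) `|` (B `+` repr (\pi_PF B))).
  by rewrite finite_setU; split; exact: finite_repr.
apply: sub_finite_set => x; rewrite /setY /=.
by case: (pselect (repr (\pi_PF A) x)); case: (pselect (A x)); tauto.
Qed.

Fact pi_pmf_compl : {morph \pi_PF : A / ~` A >-> pmf_compl A}.
Proof.
move=> A; unlock pmf_compl; apply/pmf_eqP.
have := finite_repr A.
apply: sub_finite_set => x; rewrite /setY /=.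
by case: (pselect (repr (\pi_PF A) x)); case: (pselect (A x)); tauto.
Qed.

Definition pmf_le (x y : PF) : bool := pmf_meet x y == x.
Definition pmf_lt (x y : PF) : bool := (y != x) && pmf_le x y.

Fact pmf_meetC : commutative pmf_meet.
Proof. by elim/quotW=> A; elim/quotW=> B; rewrite -!pi_pmf_meet setIC. Qed.

Fact pmf_joinC : commutative pmf_join.
Proof. by elim/quotW=> A; elim/quotW=> B; rewrite -!pi_pmf_join setUC. Qed.

Fact pmf_meetA : associative pmf_meet.
Proof.
by elim/quotW=> A; elim/quotW=> B; elim/quotW=> C; rewrite -!pi_pmf_meet setIA.
Qed.

Fact pmf_joinA : associative pmf_join.
Proof.
by elim/quotW=> A; elim/quotW=> B; elim/quotW=> C; rewrite -!pi_pmf_join setUA.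
Qed.

Fact pmf_joinKI (y x : PF) : pmf_meet x (pmf_join x y) = x.
Proof.
elim/quotW: y => B; elim/quotW: x => A.
by rewrite -pi_pmf_join -pi_pmf_meet setUC setKU.
Qed.

Fact pmf_meetKU (y x : PF) : pmf_join x (pmf_meet x y) = x.
Proof.
elim/quotW: y => B; elim/quotW: x => A.
by rewrite -pi_pmf_meet -pi_pmf_join setIC setKI.
Qed.

Fact pmf_meetUl : left_distributive pmf_meet pmf_join.
Proof.
elim/quotW=> A; elim/quotW=> B; elim/quotW=> C.
by rewrite -!(pi_pmf_meet, pi_pmf_join) setIUl.
Qed.

Fact pmf_meetxx : idempotent_op pmf_meet.
Proof. by elim/quotW=> A; rewrite -pi_pmf_meet setIid. Qed.

HB.instance Definition _ :=
  Order.isMeetJoinDistrLattice.Build (Order.Disp tt tt) PF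
    (fun _ _ => erefl) (fun _ _ => erefl) pmf_meetC pmf_joinC
    pmf_meetA pmf_joinA pmf_joinKI pmf_meetKU pmf_meetUl pmf_meetxx.

Fact pmf_le0x (x : PF) : (\pi_PF set0 <= x)%O.
Proof.
elim/quotW: x => A; rewrite leEmeet; apply/eqP.
by rewrite -[LHS]/(pmf_meet _ _) -pi_pmf_meet set0I.
Qed.

Fact pmf_lex1 (x : PF) : (x <= \pi_PF setT)%O.
Proof.
elim/quotW: x => A; rewrite leEmeet; apply/eqP.
by rewrite -[LHS]/(pmf_meet _ _) -pi_pmf_meet setIT.
Qed.

HB.instance Definition _ := Order.hasBottom.Build (Order.Disp tt tt) PF pmf_le0x.
HB.instance Definition _ := Order.hasTop.Build (Order.Disp tt tt) PF pmf_lex1.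

Fact pmf_joinxC (x : PF) : (x `|` pmf_compl x = \top)%O.
Proof.
elim/quotW: x => A.
by rewrite -[LHS]/(pmf_join _ _) -pi_pmf_compl -pi_pmf_join setUv.
Qed.

Fact pmf_meetxC (x : PF) : (x `&` pmf_compl x = \bot)%O.
Proof.
elim/quotW: x => A.
by rewrite -[LHS]/(pmf_meet _ _) -pi_pmf_compl -pi_pmf_meet setICr.
Qed.

HB.instance Definition _ :=
  Order.TBDistrLattice_hasComplement.Build (Order.Disp tt tt) PF
    pmf_joinxC pmf_meetxC.

Lemma pi_boolean_hom : boolean_hom (\pi_PF : set nat -> PF).
Proof.
by split=> //; [exact: pi_pmf_meet|exact: pi_pmf_join|exact: pi_pmf_compl].
Qed.

Lemma pmf_leP (A B : set nat) :
  (\pi_PF A <= \pi_PF B)%O <-> finite_set (A `\` B).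
Proof.
have <- : (A `&` B) `+` A = A `\` B.
  by apply/seteqP; split=> x; rewrite /setY /=; tauto.
rewrite leEmeet -[(_ `&` _)%O]/(pmf_meet _ _) -pi_pmf_meet -pmf_eqP.
by split=> /eqP.
Qed.

End PowersetModFin.

(* Main.v *)
Require Import Defs.
From mathcomp Require Import all_boot all_order all_classical topology.
From mathcomp Require Import generic_quotient.

(** A countable independent subfamily [D (tag m)] of a large independent family
[D] on the natural numbers maps [nat] to the metrizable Cantor space, so that
every infinite set contains an infinite set converging there.  Changing the
other members of the family along two convergent sets [A] and [B] does not
destroy independence, because a Boolean combination can first be shrunk away
from the two limits.  Hence for each of the continuum many pairs [(A, B)] of
convergent sets we can spend one generator to make it almost contain [B] and
avoid [A].  An automorphism [h] fixing the generators preserves convergence; if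
[h] moves something, it maps some infinite convergent [A] to an almost disjoint
[B], and the generator spent on [(A, B)] is not fixed. *)

Import Order.TTheory.
Local Open Scope classical_set_scope.
Local Open Scope quotient_scope.

(** * An independent family on the natural numbers *)

Lemma eventually_all_seq (T : eqType) (P : T -> nat -> Prop) (s : seq T) :
  (forall x, x \in s -> exists N, forall n, N <= n -> P x n) ->
  exists N, forall n, N <= n -> forall x, x \in s -> P x n.
Proof.
elim: s => [|y s IHs] Ps; first by exists 0.
have [N1 PN1] := Ps y (mem_head y s).
have [|N2 PN2] := IHs; first by move=> x xs; apply: Ps; rewrite inE xs orbT.
exists (maxn N1 N2) => n; rewrite geq_max => /andP[N1n N2n] x.
by rewrite inE => /predU1P[->|]; [exact: PN1|exact: PN2].
Qed.

(* [k] codes a finite set of binary words of length [l], that is, a clopen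
   subset of the Cantor space, and [base x] collects the codes of the clopen
   sets containing [x]. *)
Definition base (x : continuum) (k : nat) : bool :=
  if unpickle k is Some (l, F) then mkseq x l \in (F : seq (seq bool))
  else false.

(** The shift by one makes [tag m] false at 0, so a tag is never [modified]. *)
Definition tag (m : nat) : continuum := fun i => i == m.+1.

Lemma tag_fresh (s : seq continuum) : exists m, tag m \notin s.
Proof.
have [x _|N PN] := @eventually_all_seq _
    (fun (x : continuum) m => x <> tag m) s.
  have [[m ->]|xNtag] := pselect (exists m, x = tag m); last first.
    by exists 0 => n _ xn; apply: xNtag; exists n.
  exists m.+1 => n mn /(congr1 (@^~ n.+1)).
  by rewrite /tag eqxx eqSS => /eqP nm; rewrite nm ltnn in mn.
by exists N; apply/negP => /(PN N (leqnn N)).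
Qed.

(** Prefixes of a length separating the points of [s] let one code select exactly those where [q]
    holds. *)
Lemma base_independent0 (s : seq continuum) (q : continuum -> bool) :
  exists k, forall x, x \in s -> base x k = q x.
Proof.
have [x _|N PN] := @eventually_all_seq _
    (fun (x : continuum) l => forall y : continuum,
       y \in s -> mkseq x l = mkseq y l -> x = y) s.
  apply: eventually_all_seq => y _.
  have [->|xNy] := pselect (x = y); first by exists 0.
  have [i xyi] : exists i, x i <> y i.
    by apply: contrapT => xy; apply: xNy; apply/funext => i;
       apply: contrapT => xyi; apply: xy; exists i.
  exists i.+1 => l il /(congr1 (fun w => nth false w i)).
  by rewrite !nth_mkseq.
exists (pickle (N, [seq mkseq x N | x <- s & q x])) => x xs.
rewrite /base pickleK; case qx: (q x).
  by apply/mapP; exists x => //; rewrite mem_filter qx.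
apply/negbTE/mapP => -[y]; rewrite mem_filter => /andP[qy ys] xy.
by rewrite (PN N (leqnn N) x xs y ys xy) qy in qx.
Qed.

Lemma base_independent (s : seq continuum) (q : continuum -> bool) (n : nat) :
  exists2 k, n <= k & forall x, x \in s -> base x k = q x.
Proof.
elim: n s q => [|n IHn] s q.
  by have [k kP] := base_independent0 s q; exists k.
have [m ms] := tag_fresh s.
(* Prescribing the value opposite to [base (tag m) n] excludes [k = n]. *)
have [k nk kP] := IHn (tag m :: s)
  (fun x => if x == tag m then ~~ base (tag m) n else q x).
exists k => [|x xs].
  rewrite ltn_neqAle nk andbT; apply/eqP => nk'.
  by have := kP _ (mem_head _ _); rewrite eqxx -nk'; case: base.
rewrite kP ?inE ?xs ?orbT//; case: eqP => // xm.
by rewrite -xm xs in ms.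
Qed.

(** * Convergent sets of natural numbers *)

(* The image of [T] under [k |-> (base (tag m) k)_m] converges in the Cantor
   space. *)
Definition convergent (T : set nat) : Prop :=
  forall m, exists c b, forall k, b <= k -> T k -> base (tag m) k = c.

(** On each [T] a tag outside [s] is eventually a constant [c]; prescribing [~~ c] there, for [k]
    large enough, forces [k] out of [T]. *)
Lemma base_independent_off (L : seq (set nat)) (s : seq continuum)
    (q : continuum -> bool) (n : nat) :
  (forall T, T \in L -> convergent T) ->
  exists k, [/\ n <= k, forall x, x \in s -> base x k = q x
    & forall T, T \in L -> ~ T k].
Proof.
elim: L s q n => [|T L IHL] s q n convL.
  by have [k nk kP] := base_independent s q n; exists k.
have [m ms] := tag_fresh s.
have [c [b bP]] := convL T (mem_head T L) m.
have [|k [nk kP kL]] := IHL (tag m :: s)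
  (fun x => if x == tag m then ~~ c else q x) (maxn n b).
  by move=> U UL; apply: convL; rewrite inE UL orbT.
move: nk; rewrite geq_max => /andP[nk bk]; exists k; split=> // [x xs|U].
  rewrite kP ?inE ?xs ?orbT//; case: eqP => // xm.
  by rewrite -xm xs in ms.
rewrite inE => /predU1P[->|/kL//] Tk.
by have := kP _ (mem_head _ _); rewrite eqxx (bP k bk Tk); case: c {bP kP}.
Qed.

(** Sequential compactness of the Cantor space: halve repeatedly, then take a diagonal sequence. *)
Lemma infinite_convergent_subset (Y : set nat) :
  (forall b, exists2 k, b <= k & Y k) ->
  exists S : set nat, [/\ S `<=` Y, forall b, exists2 k, b <= k & S k
    & convergent S].
Proof.
move=> infY.
pose unbounded (Z : set nat) := forall b, exists2 k, b <= k & Z k.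
pose slice m (c : bool) : set nat := [set k | base (tag m) k = c].
have split_unbounded (Z : set nat) m : unbounded Z ->
    exists c, unbounded (Z `&` slice m c).
  move=> infZ; apply: contrapT => bndZ.
  have bnd c : exists b, forall k, b <= k -> Z k -> base (tag m) k <> c.
    apply: contrapT => Nb; apply: bndZ; exists c => b.
    apply: contrapT => Nk; apply: Nb; exists b => k bk Zk kc.
    by apply: Nk; exists k.
  have [b1 b1P] := bnd true; have [b2 b2P] := bnd false.
  have [k] := infZ (maxn b1 b2); rewrite geq_max => /andP[b1k b2k] Zk.
  by case kE: (base (tag m) k); [exact: (b1P k)|exact: (b2P k)].
pose next (m : nat) (Z : set nat) : set nat :=
  Z `&` slice m `[< unbounded (Z `&` slice m true) >].
pose V := fix V n : set nat := if n is m.+1 then next m (V m) else Y.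
have infV n : unbounded (V n).
  elim: n => [//|n IHn] /=; rewrite /next; case: asboolP => // NT.
  by have [[]] := split_unbounded _ n IHn.
have subV m n : m <= n -> V n `<=` V m.
  move=> mn; rewrite -(subnKC mn); elim: (n - m) => [|d IHd].
    by rewrite addn0.
  by rewrite addnS => k [/IHd].
have /choice[f fP] : forall n, exists k, n <= k /\ V n k.
  by move=> n; have [k nk Vk] := infV n n; exists k.
exists (range f); split.
- by move=> _ [n _ <-]; apply: (subV 0 n) => //; exact: (fP n).2.
- by move=> b; exists (f b); [exact: (fP b).1|exists b].
move=> m; exists `[< unbounded (V m `&` slice m true) >].
(* Beyond all of [f 0], ..., [f m], a value [f n] must have [n > m], hence lies in [V m.+1]. *)
have [|N PN] := @eventually_all_seq _ (fun i k => f i < k) (iota 0 m.+1).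
  by move=> i _; exists (f i).+1.
exists N => k Nk [n _ fnk]; rewrite -fnk in Nk *.
have [nm|mn] := leqP n m; last first.
  by have [_] := subV m.+1 n mn _ (fP n).2.
have := PN _ Nk n; rewrite mem_iota ltnn /= add0n ltnS.
by move=> /(_ nm).
Qed.

(** * Spending generators on pairs of convergent sets *)

(** An index doubles as the code of a pair of sets: odd places give one, positive even places the
    other, and place 0 is a flag that tags leave off. *)
Definition avoided (x : continuum) : set nat := [set k | x k.*2.+1].
Definition absorbed (x : continuum) : set nat := [set k | x k.*2.+2].

Definition pair_code (A B : set nat) : continuum := fun i =>
  if i is j.+1 then if odd j then `[< B j./2 >] else `[< A j./2 >] else true.

Lemma avoided_pair_code (A B : set nat) : avoided (pair_code A B) = A.
Proof.
apply/seteqP; split=> k; rewrite /avoided /= odd_double doubleK.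
  by move/asboolP.
by move=> Ak; apply/asboolP.
Qed.

Lemma absorbed_pair_code (A B : set nat) : absorbed (pair_code A B) = B.
Proof.
apply/seteqP; split=> k; rewrite /absorbed /= odd_double uphalf_double.
  by move/asboolP.
by move=> Bk; apply/asboolP.
Qed.

Definition modified (x : continuum) : Prop :=
  [/\ x 0, convergent (avoided x) & convergent (absorbed x)].

Definition gen (x : continuum) (k : nat) : bool :=
  if `[< modified x >] then (base x k || x k.*2.+2) && ~~ x k.*2.+1
  else base x k.

Lemma gen_tag (m k : nat) : gen (tag m) k = base (tag m) k.
Proof. by rewrite /gen; case: asboolP => // -[]. Qed.

(** Off the finitely many avoided and absorbed sets attached to [s], [gen] agrees with [base]. *)
Lemma gen_independent (s : seq continuum) (q : continuum -> bool) (n : nat) :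
  exists2 k, n <= k & forall x, x \in s -> gen x k = q x.
Proof.
pose s' := [seq x <- s | `[< modified x >]].
have [|k [nk kP kL]] := base_independent_off
    (map avoided s' ++ map absorbed s') s q n.
  move=> T; rewrite mem_cat => /orP[] /mapP[x] + ->;
    by rewrite mem_filter => /andP[/asboolP[]].
exists k => // x xs; rewrite /gen; case: ifP => [xmod|_]; last exact: kP.
have xs' : x \in s' by rewrite mem_filter xmod.
have /negP/negbTE -> : ~ avoided x k.
  by apply: kL; rewrite mem_cat map_f.
have /negP/negbTE -> : ~ absorbed x k.
  by apply: kL; rewrite mem_cat map_f ?orbT.
by rewrite orbF andbT kP.
Qed.

(** * The embedding of the clopen algebra *)

(** The sets containing a cylinder around [q] form a filter, which converges to [q] because it does
    so in each coordinate. *)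
Lemma cantor_open_cylinder (I : eqType) (U : set (cantor_cube I))
    (q : cantor_cube I) :
  open U -> U q ->
  exists s : seq I, forall y : cantor_cube I,
    (forall i, i \in s -> y i = q i) -> U y.
Proof.
move=> openU Uq.
pose F : set_system (cantor_cube I) := [set P | exists s : seq I,
  forall y : cantor_cube I, (forall i, i \in s -> y i = q i) -> P y].
have FF : Filter F.
  split=> [|P Q [s sP] [t tQ]|P Q PQ [s sP]]; first by exists [::].
    exists (s ++ t) => y yq.
    split; [apply: sP|apply: tQ] => i it;
      by apply: yq; rewrite mem_cat it ?orbT.
  by exists s => y /sP /PQ.
have Fq : F --> q.
  apply/cvg_sup => i V [W] [[Z] oZ <-] Zq ZV.
  exists [:: i] => y /(_ i (mem_head _ _)) yq; apply: ZV.
  by rewrite /= yq.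
by apply: Fq; apply: open_nbhs_nbhs.
Qed.

Definition point (k : nat) : cantor_cube continuum := fun x => gen x k.

(** Arbitrarily large [k] are needed for injectivity modulo finite sets. *)
Lemma point_dense (U : set (cantor_cube continuum)) (n : nat) :
  open U -> U !=set0 -> exists2 k, n <= k & U (point k).
Proof.
move=> openU [q Uq]; have [s sU] := @cantor_open_cylinder _ _ _ openU Uq.
by have [k nk kq] := gen_independent s q n; exists k => //; exact: sU.
Qed.

Lemma pi_leP (A B : set nat) :
  (\pi_powerset_mod_fin A <= \pi_powerset_mod_fin B)%O <->
  exists b, forall k, b <= k -> A k -> B k.
Proof.
rewrite pmf_leP; split=> [finAB|[b bP]].
  have [s sE] := (finite_seqP _).1 finAB.
  exists (\max_(i <- s) i).+1 => k sk Ak; apply: contrapT => NBk.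
  have : [set` s] k by rewrite -sE.
  move=> /= ks; have := @leq_bigmax_seq _ s xpredT id k ks isT.
  by rewrite leqNgt sk.
apply: (@sub_finite_set _ _ `I_b) => [k [Ak NBk]|]; last exact: finite_II.
by rewrite /= ltnNge; apply/negP => /bP /(_ Ak).
Qed.

Definition embed (U : clopen_algebra (cantor_cube continuum)) :
    powerset_mod_fin :=
  \pi_powerset_mod_fin (point @^-1` clopen_set U).

Lemma embed_embedding : boolean_embedding embed.
Proof.
have [piI piU piC pi0 pi1] := pi_boolean_hom.
have [[clI clU clC cl0 cl1] _] := clopen_set_embedding (cantor_cube continuum).
have embedN0 (U V : clopen_algebra (cantor_cube continuum)) :
    (embed U <= embed V)%O -> clopen_set U `<=` clopen_set V.
  move=> /pi_leP[b bP] q Uq; apply: contrapT => NVq.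
  have [|| k bk [Uk NVk]] := @point_dense (clopen_set U `&` ~` clopen_set V) b.
  - have [/set_mem[oU _] /set_mem clV] := (valP U, valP V).
    by apply: openI => //; exact: (clopenC (~` clopen_set V) clV).1.
  - by exists q.
  by apply: NVk; exact: bP.
split; last first.
  move=> U V UV; apply/val_inj/seteqP.
  by split; apply: embedN0; rewrite UV.
rewrite /embed; split=> [U V|U V|U||].
- by rewrite clI -piI.
- by rewrite clU -piU.
- by rewrite clC -piC.
- by rewrite cl0 -pi0.
- by rewrite cl1 -pi1.
Qed.

Lemma clopen_coordinate (x : continuum) :
  [set y : cantor_cube continuum | y x] \in @clopens (cantor_cube continuum).
Proof.
have cont : continuous (fun y : cantor_cube continuum => y x : bool).
  exact: (@proj_continuous continuum (fun=> bool)).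
apply/mem_set; apply: (preimage_clopen (A := [set b : bool | b]) _ cont).
by split; [exact: discrete_open|exact: discrete_closed].
Qed.

Lemma embed_coordinate (x : continuum) :
  embed (ClopenAlgebra (clopen_coordinate x)) =
  \pi_powerset_mod_fin [set k | gen x k].
Proof. by []. Qed.


(** * Automorphisms fixing the generators *)

Lemma boolean_hom_le {d1 d2 : Order.disp_t} (B : ctbDistrLatticeType d1)
    (A : ctbDistrLatticeType d2) (f : B -> A) :
  boolean_hom f -> {homo f : x y / (x <= y)%O}.
Proof. by move=> [fI _ _ _ _] x y; rewrite !leEmeet -fI => /eqP ->. Qed.

Local Notation pi := (\pi_powerset_mod_fin).

Lemma pi_setC (A : set nat) : pi (~` A) = (~` pi A)%O.
Proof. by have [_ _ + _ _] := pi_boolean_hom; apply. Qed.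

Section Stabilizer.
Variable h : powerset_mod_fin -> powerset_mod_fin.
Hypothesis h_stab : pointwise_stabilizer embed h.

Let h_hom : boolean_hom h. Proof. by case: h_stab => -[]. Qed.

Let h_gen (x : continuum) : h (pi [set k | gen x k]) = pi [set k | gen x k].
Proof. by rewrite -embed_coordinate; apply: h_stab.2; eexists. Qed.

(** Convergence of [S] means that, for each [m], the class of [S] lies below a fixed element, namely
    the generator of [tag m] or its complement. *)
Lemma stabilizer_convergent (S S' : set nat) :
  convergent S -> h (pi S) = pi S' -> convergent S'.
Proof.
move=> convS hS m; have [[] [b bP]] := convS m.
  have /(boolean_hom_le _ _ _ h_hom) : (pi S <= pi [set k | gen (tag m) k])%O.
    by apply/pi_leP; exists b => k bk Sk; rewrite /= gen_tag bP.
  rewrite hS h_gen => /pi_leP[b' b'P]; exists true, b' => k bk S'k.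
  by rewrite -gen_tag; exact: b'P.
have [_ _ hC _ _] := h_hom.
have /(boolean_hom_le _ _ _ h_hom) :
    (pi S <= pi (~` [set k | gen (tag m) k])%classic)%O.
  by apply/pi_leP; exists b => k bk Sk; rewrite /setC /= gen_tag bP.
rewrite hS pi_setC hC h_gen -pi_setC => /pi_leP[b' b'P].
exists false, b' => k bk S'k.
by rewrite -gen_tag; apply/negbTE/negP; exact: b'P.
Qed.

Lemma stabilizer_ge (y : powerset_mod_fin) : (y <= h y)%O.
Proof.
have [_ _ hC h0 _] := h_hom; have [_ _ _ pi0 _] := pi_boolean_hom.
have hinj : injective h by case: h_stab => -[_ /bij_inj].
elim/quotW: y => Y; have [Z hY] : exists Z, h (pi Y) = pi Z.
  by exists (repr (h (pi Y))); rewrite reprK.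
rewrite hY; apply/pi_leP; apply: contrapT => NYZ.
have [|S [SYZ infS convS]] := infinite_convergent_subset (Y `\` Z).
  move=> b; apply: contrapT => Nb; apply: NYZ; exists b => k bk Yk.
  by apply: contrapT => NZk; apply: Nb; exists k.
have [S' hS] : exists S', h (pi S) = pi S'.
  by exists (repr (h (pi S))); rewrite reprK.
have convS' := stabilizer_convergent _ _ convS hS.
(* As [S] lies in [Y], its image lies almost inside [Z], hence is almost disjoint from [S]. *)
have [b1 S'Z] : exists b, forall k, b <= k -> S' k -> Z k.
  apply/pi_leP; rewrite -hS -hY; apply: boolean_hom_le h_hom _ _ _.
  by apply/pi_leP; exists 0 => k _ /SYZ[].
pose x := pair_code S S'.
have genE k : gen x k = (base x k || `[< S' k >]) && ~~ `[< S k >].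
  rewrite /gen asboolT; last first.
    by split; rewrite ?avoided_pair_code ?absorbed_pair_code.
  by rewrite /= odd_double /= uphalf_double doubleK.
have /(boolean_hom_le _ _ _ h_hom) :
    (pi S <= pi (~` [set k | gen x k])%classic)%O.
  by apply/pi_leP; exists 0 => k _ Sk; rewrite /setC /= genE (asboolT Sk) andbF.
rewrite hS pi_setC hC h_gen -pi_setC => /pi_leP[b2 S'Ngen].
(* Almost all of [S'] is both inside the generator of [x], by absorption, and outside it, as the
   image of the avoided [S]. So [S'] is finite, and by injectivity so is [S]. *)
have S0 : pi S = pi set0.
  apply: hinj; rewrite hS [pi set0]pi0 h0; apply/le_anti; rewrite le0x andbT.
  rewrite -pi0; apply/pi_leP; exists (maxn b1 b2) => k.
  rewrite geq_max => /andP[b1k b2k] S'k; apply: (S'Ngen k b2k S'k).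
  rewrite /setC /= genE (asboolT S'k) orbT /=; apply/asboolPn => /SYZ[_].
  by apply; exact: S'Z.
have /pi_leP[b bP] : (pi S <= pi set0)%O by rewrite S0.
by have [k /bP] := infS b.
Qed.

(** The reverse inequality is [stabilizer_ge] at the complement. *)
Lemma stabilizer_id : h = id.
Proof.
apply/funext => y; apply/le_anti; rewrite stabilizer_ge andbT.
have [_ _ hC _ _] := h_hom.
by have := stabilizer_ge (~` y)%O; rewrite hC Order.CTBDistrLatticeTheory.leC.
Qed.

End Stabilizer.

Lemma id_stabilizer {d1 d2 : Order.disp_t} (B : ctbDistrLatticeType d1)
    (A : ctbDistrLatticeType d2) (e : B -> A) : pointwise_stabilizer e id.
Proof. by split=> //; split; [split|exists id]. Qed.

Theorem theorem4p2 :
  exists e : clopen_algebra (cantor_cube continuum) -> powerset_mod_fin,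
    boolean_embedding e /\ pointwise_stabilizer e = [set id]%classic.
Proof.
exists embed; split; first exact: embed_embedding.
apply/seteqP; split=> [h|_ ->]; first exact: stabilizer_id.
exact: id_stabilizer.
Qed.
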